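(* Let $A,B\subset\mathbb{R}$ be finite sets with $|A|^{5/3}\ge |B|\ge |A|^{3/5}$, and let $P=A\times B$. Let $l_\infty$ denote the line at infinity of the real projective plane, and let $l_1$ be an arbitrary line in $\mathbb{R}^2$ which is neither vertical nor horizontal. Then \[ \max\{|L(P)\cap l_\infty|,\ |L(P)\cap l_1|\} \gg |A|^{15/14}|B|^{15/14}. \]
   Context: For a finite set $P\subset\mathbb{R}^2$, $L(P)$ denotes the set of lines containing at least two points of $P$. For a line $l$ of the projective plane, $L(P)\cap l$ denotes the set of points at which lines of $L(P)$ (viewed as projective lines) intersect $l$; in particular $L(P)\cap l_\infty$ is the set of directions determined by lines of $L(P)$. The notation $X\gg Y$ means $X\ge cY$ for an absolute constant $c>0$.
   Formalization: The case |A| = |B| = 1 is excluded: there P is a single point, L(P) is empty, and the claimed inequality would read 0 ≥ c with c > 0, which is false. *)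

(* Defs.v *)
From mathcomp Require Export all_boot all_order all_algebra finmap.
From mathcomp Require Export classical_sets cardinality reals exp.
Set Implicit Arguments.
Unset Strict Implicit.
Unset Printing Implicit Defensive.
Import Order.TTheory GRing.Theory Num.Theory.
Local Open Scope classical_set_scope.
Local Open Scope ring_scope.

(* The real projective plane is the plane of subspaces of R^3: its points are
   the 1-dimensional subspaces, its lines the 2-dimensional ones, and
   incidence is inclusion. *)
Notation pspace R := {vspace 'rV[R]_3}.

Definition hvec (R : realType) (x y z : R) : 'rV[R]_3 :=
  \row_(i < 3) [:: x; y; z]`_i.

(* (x, y) in R^2 is the projective point [x : y : 1]. *)
Definition hpt (R : realType) (p : R * R) : 'rV[R]_3 := hvec p.1 p.2 1.

Definition is_ppoint (R : realType) (x : pspace R) : Prop := \dim x = 1%N.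

Definition is_pline (R : realType) (l : pspace R) : Prop := \dim l = 2.

Definition linfty (R : realType) : pspace R :=
  (<[hvec 1 0 0]> + <[hvec 0 1 0]>)%VS.

Definition affine_part (R : realType) (l : pspace R) : set (R * R) :=
  [set p | hpt p \in l].

Definition is_affine_line (R : realType) (l : pspace R) : Prop :=
  is_pline l /\ l <> linfty R.

Definition vertical (R : realType) (l : pspace R) : Prop :=
  exists a : R, affine_part l = [set p | p.1 = a].

Definition horizontal (R : realType) (l : pspace R) : Prop :=
  exists b : R, affine_part l = [set p | p.2 = b].

(* L(P), each line being identified with its projective closure. *)
Definition Lines (R : realType) (P : {fset R * R}) : set (pspace R) :=
  [set l | is_affine_line l /\
     exists p q, [/\ p \in P, q \in P, p <> q,
                     affine_part l p & affine_part l q]].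

(* The points at which lines of L(P) meet l.  If l itself belongs to L(P) it
   does not count as meeting l in a point: only lines m <> l are used. *)
Definition LinesOn (R : realType) (P : {fset R * R}) (l : pspace R)
    : set (pspace R) :=
  [set x | is_ppoint x /\
     exists m, [/\ Lines P m, m <> l, (x <= m)%VS & (x <= l)%VS]].

Definition nmeet (R : realType) (P : {fset R * R}) (l : pspace R) : nat :=
  #|` fset_set (LinesOn P l)|.

(* [fset_set] is empty on infinite sets; the facts below show that the set
   counted by [nmeet] is finite, so [nmeet] is its cardinality. *)
Lemma hpt_neq0 (R : realType) (p : R * R) : hpt p != 0.
Proof.
apply/eqP => /rowP /(_ (inord 2)); rewrite !mxE inordK //=.
exact/eqP/oner_neq0.
Qed.

Lemma hpt_join_dim (R : realType) (p q : R * R) :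
  p <> q -> \dim (<[hpt p]> + <[hpt q]>) = 2.
Proof.
move=> neq; rewrite dimv_disjoint_sum ?dim_vline ?hpt_neq0 //.
apply/eqP; rewrite -subv0; apply/subvP => v /memv_capP[/vlineP[a ->]].
move=> /vlineP[b /rowP e].
have := e (inord 0); have := e (inord 1); have := e (inord 2).
rewrite !mxE !inordK //= !mulr1 => <- e1 e0.
have [->|a0] := eqVneq a 0; first by rewrite scale0r mem0v.
case: neq; move: p q e e0 e1 => [p1 p2] [q1 q2] /= _.
by move=> /(mulfI a0) -> /(mulfI a0) ->.
Qed.

Lemma Lines_finite (R : realType) (P : {fset R * R}) : finite_set (Lines P).
Proof.
pose f (pq : (R * R) * (R * R)) := (<[hpt pq.1]> + <[hpt pq.2]>)%VS.
apply: (@sub_finite_set _ _ (f @` [set` (P `*` P)%fset])); last first.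
  exact/finite_image/finite_fset.
move=> l [[dl _] [p [q [pP qP neq pl ql]]]]; exists (p, q) => /=.
  by rewrite in_fsetM pP qP.
apply/eqP; rewrite eqEdim dl hpt_join_dim // leqnn andbT.
by rewrite subv_add -!memvE; apply/andP.
Qed.

Lemma LinesOn_finite (R : realType) (P : {fset R * R}) (l : pspace R) :
  is_pline l -> finite_set (LinesOn P l).
Proof.
move=> dl.
apply: (@sub_finite_set _ _ ((fun m => (m :&: l)%VS) @` Lines P)); last first.
  exact/finite_image/Lines_finite.
move=> x [dx [m [mP neq xm xl]]]; exists m => //; apply/esym/eqP.
rewrite eqEdim subv_cap xm xl dx /= leqNgt; apply/negP => dml.
have dm : \dim m = 2 by case: mP => [] [].
apply: neq; transitivity (m :&: l)%VS.
  by apply/esym/eqP; rewrite eqEdim capvSl dm.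
by apply/eqP; rewrite eqEdim capvSr dl.
Qed.

(* Main.v *)
(** After an affine change of the first coordinate [l1] is the line [y = x].
    Attach to a point [(a, b)] of [A x B] the affine map
    [u |-> a + u (b - a)].  Two points whose join has slope [d <> 1] and meets
    [y = x] at height [t] have maps agreeing at [u = 1 / (1 - d)], with common
    value [t].  So the crossings of these [N = |A||B|] maps lie in a product
    [U x T] with [|U|] and [|T|] at most [X], the maximum to be bounded below.

    A Szemeredi-Trotter bound for cartesian products shows that most points
    see [>> N] slopes, i.e. that there are [>> N^2] incidences between the
    maps and [U x T].  By Cauchy-Schwarz, [>> N^4 / X] quadruples
    [(f, g, u, v)] satisfy [f u = g v], so that the maps [f^-1 g] carry many
    elements of [U] into [U].  Rich maps of [U] into itself are few, again by
    Szemeredi-Trotter, which bounds the number of such quadruples in terms of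
    the energy [E = #{f^-1 g = h^-1 k}].  Since [f^-1 g = h^-1 k] says that a
    single affine map carries the ends [a, b] of [f] to those of [h] and the
    ends of [g] to those of [k], [E] is at most the sum over affine maps of
    [rich_A^2 rich_B^2], which is [<< N^(5/2)].  Altogether [X^7 >> N^(15/2)]. *)
Require Import Defs.
From mathcomp Require Import ring zify.
Set Implicit Arguments.
Unset Strict Implicit.
Unset Printing Implicit Defensive.
Import Order.TTheory GRing.Theory Num.Theory.

(** * Finite sums *)

Lemma sum_indicator (T : Type) (s : seq T) (P : pred T) :
  \sum_(x <- s) (P x : nat) = count P s.
Proof.
by rewrite -sum1_count [RHS]big_mkcond; apply: eq_bigr => x _; case: (P x).
Qed.

Lemma sum_eq_indicator (T : eqType) (s : seq T) (x : T) :
  uniq s -> \sum_(y <- s) ((x == y) : nat) = (x \in s).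
Proof.
move=> us; rewrite -(count_uniq_mem _ us) -sum_indicator.
by apply: eq_bigr => y _; rewrite eq_sym.
Qed.

Lemma sum_indicator_le1 (T : eqType) (s : seq T) (P : pred T) :
  uniq s -> {in s &, forall x y, P x -> P y -> x = y} ->
  \sum_(x <- s) (P x : nat) <= 1.
Proof.
move=> us Pinj; rewrite sum_indicator.
have [/hasP[x xs Px]|/hasPn nP] := boolP (has P s); last first.
  suff -> : count P s = 0 by [].
  by apply/eqP; rewrite -leqn0 leqNgt -has_count; apply/hasPn.
apply: leq_trans (_ : count_mem x s <= 1); last first.
  by rewrite count_uniq_mem // leq_b1.
rewrite -!sum_indicator big_seq [leqRHS]big_seq.
apply: leq_sum => y ys; case Py: (P y) => //=.
by rewrite (Pinj _ _ ys xs Py Px) eqxx.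
Qed.

Lemma sum_fibers (I K : eqType) (s : seq I) (ks : seq K) (f : I -> K)
    (F : I -> nat) :
  uniq ks -> {in s, forall x, f x \in ks} ->
  \sum_(x <- s) F x = \sum_(k <- ks) \sum_(x <- s) (f x == k) * F x.
Proof.
move=> uk fk; rewrite exchange_big; apply: eq_big_seq => x xs.
by rewrite -big_distrl /= sum_eq_indicator // fk // mul1n.
Qed.

Lemma sum_cauchy_schwarz (I : Type) (s : seq I) (f g : I -> nat) :
  (\sum_(i <- s) f i * g i) ^ 2 <=
  (\sum_(i <- s) f i ^ 2) * (\sum_(i <- s) g i ^ 2).
Proof.
(* After doubling, the term at [(i, j)] is 2xy <= x^2 + y^2 with x = [f i * g j] and y =
   [g i * f j]. *)
rewrite -(leq_pmul2l (isT : 0 < 2)) (mul2n (_ * _)) -addnn.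
rewrite [X in _ <= _ + X]mulnC -mulnn !big_distrl big_distrr -big_split /=.
apply: leq_sum => i _; rewrite !big_distrr -big_split /=.
apply: leq_sum => j _.
by have := (nat_Cauchy (f i * g j) (g i * f j)).1; rewrite !expnMn; lia.
Qed.

Lemma sum_square_le (I : Type) (s : seq I) (f : I -> nat) :
  (\sum_(i <- s) f i) ^ 2 <= size s * \sum_(i <- s) f i ^ 2.
Proof.
have := sum_cauchy_schwarz s (fun=> 1) f.
rewrite exp1n sum1_size.
by under eq_bigr do rewrite mul1n.
Qed.

(** Cauchy-Schwarz over the [v] possible values: the pairs with equal value number the sum of the
    squared fibre sizes. *)
Lemma equal_value_pairs (I : eqType) (s : seq I) (g : I -> nat) (v : nat) :
  {in s, forall x, g x < v} ->
  size s ^ 2 <= v * \sum_(x <- s) \sum_(y <- s) (g x == g y).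
Proof.
move=> gv.
have mem x : x \in s -> g x \in iota 0 v.
  by move=> xs; rewrite mem_iota add0n gv.
have -> : \sum_(x <- s) \sum_(y <- s) (g x == g y) =
    \sum_(k <- iota 0 v) (\sum_(x <- s) (g x == k)) ^ 2.
  under [RHS]eq_bigr => k _ do rewrite -mulnn big_distrl /=.
  rewrite [RHS]exchange_big; apply: eq_big_seq => x xs.
  under [RHS]eq_bigr => k _ do rewrite big_distrr /=.
  rewrite [RHS]exchange_big; apply: eq_bigr => y _.
  rewrite (bigD1_seq (g x)) ?iota_uniq ?mem //= eqxx mul1n big1 ?addn0 => [|k].
    by rewrite eq_sym.
  by rewrite eq_sym => /negPf ->.
rewrite -{1}(size_iota 0 v); apply: leq_trans (sum_square_le _ _).
rewrite leq_sqr exchange_big -sum1_size big_seq [leqRHS]big_seq.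
apply: leq_sum => x xs.
by rewrite sum_eq_indicator ?iota_uniq ?mem.
Qed.

Lemma sum_le_size (I : eqType) (s : seq I) (F : I -> nat) (c : nat) :
  {in s, forall x, F x <= c} -> \sum_(x <- s) F x <= size s * c.
Proof.
move=> Fc; rewrite -sum1_size big_distrl big_seq [leqRHS]big_seq /=.
by apply: leq_sum => x xs; rewrite mul1n Fc.
Qed.

(** * Incidences in a cartesian product *)

(** A pair (slope, intercept) serves both as a line and as an affine map, so [rich] below counts
    either grid points on a line or elements of [A] sent into [B]. *)
Definition affine (R : realFieldType) (l : R * R) (x : R) : R :=
  (l.1 * x + l.2)%R.

Definition rich (R : realFieldType) (A B : seq R) (l : R * R) : nat :=
  \sum_(a <- A) (affine l a \in B).

(** Cells are blocks of [w] consecutive ranks, hence balanced however [A] is spaced. *)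
Definition cell (R : realFieldType) (A : seq R) (w : nat) (a : R) : nat :=
  count (fun x => x < a)%R A %/ w.

Lemma affine_inj (R : realFieldType) (l : R * R) :
  (l.1 != 0)%R -> injective (affine l).
Proof. by move=> l0 x y /addIr /(mulfI l0). Qed.

Lemma affine_eq2 (R : realFieldType) (l l' : R * R) (x y : R) :
  x != y -> affine l x = affine l' x -> affine l y = affine l' y -> l = l'.
Proof.
case: l l' => [m c] [m' c'] /= xy; rewrite /affine /= => e1 e2.
have e : ((m - m') * (x - y) = 0)%R.
  have -> : ((m - m') * (x - y) =
    (m * x + c - (m' * x + c')) - (m * y + c - (m' * y + c')))%R by ring.
  by rewrite e1 e2 !subrr.
move/eqP: e; rewrite mulf_eq0 (subr_eq0 x y) (negPf xy) orbF subr_eq0.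
by move=> /eqP mm; move: e1; rewrite mm => /addrI ->.
Qed.

Lemma rich_le_size1 (R : realFieldType) (A B : seq R) (l : R * R) :
  rich A B l <= size A.
Proof. by rewrite /rich -sum1_size; apply: leq_sum => a _; apply: leq_b1. Qed.

Lemma richE (R : realFieldType) (A B : seq R) (l : R * R) :
  uniq B -> rich A B l = \sum_(a <- A) \sum_(b <- B) (affine l a == b).
Proof. by move=> uB; apply: eq_bigr => a _; rewrite sum_eq_indicator. Qed.

Lemma rich_le_size2 (R : realFieldType) (A B : seq R) (l : R * R) :
  (l.1 != 0)%R -> uniq A -> uniq B -> rich A B l <= size B.
Proof.
move=> l0 uA uB; rewrite richE // exchange_big -sum1_size.
apply: leq_sum => b _; apply: sum_indicator_le1 => // x y _ _.
by move=> /eqP <- /eqP /(affine_inj l0).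
Qed.

Lemma cell_mono (R : realFieldType) (A : seq R) (w : nat) (x y : R) :
  (x <= y)%R -> cell A w x <= cell A w y.
Proof.
move=> xy; apply: leq_div2r; apply: sub_count => z /= zx.
exact: lt_le_trans zx xy.
Qed.

Lemma rank_lt_size (R : realFieldType) (A : seq R) (a : R) :
  a \in A -> count (fun x => x < a)%R A < size A.
Proof.
move=> aA; rewrite -(count_predC (fun x => x < a)%R A) -addn1 leq_add2l.
by rewrite -has_count; apply/hasP; exists a => //=; rewrite ltxx.
Qed.

Lemma rank_lt (R : realFieldType) (A : seq R) (a b : R) :
  a \in A -> (a < b)%R ->
  count (fun x => x < a)%R A < count (fun x => x < b)%R A.
Proof.
move=> aA ab; rewrite -!size_filter.
have -> : [seq x <- A | (x < a)%R] = [seq x <- [seq x <- A | (x < b)%R] | (x < a)%R].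
  rewrite -filter_predI; apply: eq_filter => x /=.
  by case: ltP => //= xa; rewrite (lt_trans xa ab).
rewrite size_filter; apply: rank_lt_size.
by rewrite mem_filter ab.
Qed.

Lemma cell_bound (R : realFieldType) (A : seq R) (w k c : nat) (a : R) :
  a \in A -> c * size A < w * k -> c * cell A w a < k.
Proof.
move=> aA h; rewrite /cell; have := rank_lt_size aA.
move: (count _ A) => r rA; have := leq_trunc_div r w.
move: (r %/ w) => q; nia.
Qed.

(** Rank is injective on [A], and the ranks in one cell lie in an interval of [w] integers. *)
Lemma cell_size (R : realFieldType) (A : seq R) (w : nat) (a : R) :
  uniq A -> 0 < w -> \sum_(x <- A) (cell A w a == cell A w x) <= w.
Proof.
move=> uA w0; rewrite sum_indicator -size_filter.
set s := filter _ _.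
rewrite -(size_map (fun y => count (fun x => x < y)%R A)).
rewrite -{1}(size_iota (cell A w a * w) w).
apply: uniq_leq_size.
  rewrite map_inj_in_uniq ?filter_uniq // => x y.
  rewrite !mem_filter => /andP[_ xA] /andP[_ yA] e.
  case: (ltgtP x y) => // xy; [have := rank_lt xA xy | have := rank_lt yA xy];
    by rewrite e ltnn.
move=> r /mapP[x]; rewrite mem_filter => /andP[/eqP ax xA] ->.
rewrite mem_iota ax /cell leq_trunc_div /=.
by rewrite -mulSnr ltn_ceil.
Qed.

Definition close_pairs (R : realFieldType) (A B : seq R) (w w' : nat)
    (l : R * R) : nat :=
  \sum_(x <- A | affine l x \in B) \sum_(y <- A | affine l y \in B)
    [&& x != y, cell A w x == cell A w y &
        cell B w' (affine l x) == cell B w' (affine l y)].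

(* Along a monotone line the cell index [cell x + cell (l x)] (with the second
   term reversed on decreasing lines) determines the cell, so a line visits few
   cells and many of its points share one. *)
Lemma rich_le_close_pairs (R : realFieldType) (A B : seq R) (w w' k : nat)
    (l : R * R) :
  uniq A -> 1 < k -> 8 * size A < w * k -> 8 * size B < w' * k ->
  (l.1 != 0)%R -> k <= rich A B l ->
  rich A B l ^ 2 <= k * close_pairs A B w w' l.
Proof.
move=> uA k1 wk wk' l0 kr.
pose s := [seq a <- A | affine l a \in B].
have ss : size s = rich A B l by rewrite size_filter /rich sum_indicator.
have us : uniq s by rewrite filter_uniq.
(* Cell indices are at most [h], so [g] takes at most 2h + 1 values, and 2(2h + 1) <= k because k >
   1. *)
pose h := k.-1 %/ 8.
have cA x : x \in s -> cell A w x <= h.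
  rewrite mem_filter => /andP[_ xA]; rewrite /h leq_divRL //.
  have := cell_bound xA wk; lia.
have cB x : x \in s -> cell B w' (affine l x) <= h.
  rewrite mem_filter => /andP[xB _]; rewrite /h leq_divRL //.
  have := cell_bound xB wk'; lia.
pose g x := cell A w x + (if (0 < l.1)%R then cell B w' (affine l x)
                          else h - cell B w' (affine l x)).
have gh : {in s, forall x, g x < (2 * h).+1}.
  by move=> x xs; rewrite /g; have := cA x xs; have := cB x xs; case: ifP; lia.
have gcell x y : x \in s -> y \in s -> g x = g y ->
    (cell A w x == cell A w y) &&
    (cell B w' (affine l x) == cell B w' (affine l y)).
  wlog xy : x y / (x <= y)%R.
    move=> W xs ys e; case: (leP x y) => [xy|/ltW yx]; first exact: W.
    by rewrite eq_sym [X in _ && X]eq_sym; apply: W.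
  move=> xs ys; rewrite /g.
  have := cA x xs; have := cB x xs; have := cA y ys; have := cB y ys.
  have := cell_mono A w xy.
  case: ifP => [lp|/negbT ln].
    have /(cell_mono B w') : (affine l x <= affine l y)%R.
      by rewrite /affine lerD2r ler_pM2l.
    lia.
  have /(cell_mono B w') : (affine l y <= affine l x)%R.
    by rewrite /affine lerD2r ler_nM2l // lt_neqAle l0 leNgt.
  lia.
have := equal_value_pairs gh; rewrite ss.
set G := (X in _ * X).
have GP : G <= close_pairs A B w w' l + rich A B l.
  rewrite /close_pairs -big_filter -/s -ss -sum1_size -big_split /=.
  rewrite /G big_seq [leqRHS]big_seq; apply: leq_sum => x xs.
  rewrite -[X in _ <= X + _]big_filter -/s.
  have -> : 1 = \sum_(y <- s) (x == y) by rewrite sum_eq_indicator // xs.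
  rewrite -big_split big_seq [leqRHS]big_seq; apply: leq_sum => y ys /=.
  case: eqP => // /(gcell _ _ xs ys) ->.
  by case: (x == y).
have h2 : 2 * (2 * h).+1 <= k.
  have := leq_trunc_div k.-1 8; rewrite -/h; lia.
move: (rich A B l) kr GP => r kr GP; move: G GP => G GP.
move: (close_pairs _ _ _ _ _) GP => P GP; rewrite -mulnn => e1.
(* The factor 2 absorbs the diagonal pairs: 2r^2 <= kG <= kP + kr <= kP + r^2. *)
have e2 : 2 * (r * r) <= k * G by nia.
nia.
Qed.

(** Two points with distinct abscissae determine the line, so no pair is counted twice; each grid
    point shares its cell with at most [w * w'] points. *)
Lemma sum_close_pairs_le (R : realFieldType) (A B : seq R) (w w' : nat)
    (L : seq (R * R)) :
  uniq A -> uniq B -> uniq L -> 0 < w -> 0 < w' ->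
  \sum_(l <- L) close_pairs A B w w' l <= size A * w * (size B * w').
Proof.
move=> uA uB uL w0 w0'.
pose cA x y : nat := cell A w x == cell A w y.
pose cB x y : nat := cell B w' x == cell B w' y.
apply: (@leq_trans (\sum_(x <- A) \sum_(y <- A) \sum_(b <- B) \sum_(b' <- B)
    cA x y * cB b b')); last first.
  apply: (@leq_trans ((\sum_(x <- A) \sum_(y <- A) cA x y) *
                      (\sum_(b <- B) \sum_(b' <- B) cB b b'))).
    rewrite big_distrl /=; apply: leq_sum => x _.
    rewrite big_distrl /=; apply: leq_sum => y _.
    rewrite big_distrr /=; apply: leq_sum => b _.
    by rewrite big_distrr.
  by apply: leq_mul; apply: sum_le_size => x _; apply: cell_size.
have step l : close_pairs A B w w' l <=
    \sum_(x <- A) \sum_(y <- A) \sum_(b <- B) \sum_(b' <- B)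
      [&& x != y, affine l x == b & affine l y == b'] * (cA x y * cB b b').
  rewrite /close_pairs big_mkcond; apply: leq_sum => x _.
  case: ifP => // lxB; rewrite big_mkcond; apply: leq_sum => y _.
  case: ifP => // lyB; rewrite (bigD1_seq _ lxB uB) /=.
  apply: leq_trans (leq_addr _ _); rewrite (bigD1_seq _ lyB uB) /=.
  apply: leq_trans (leq_addr _ _); rewrite !eqxx /cA /cB.
  by case: (x != y); case: (cell A w x == _); case: (cell B w' _ == _).
apply: leq_trans (leq_sum _ (fun l _ => step l)) _.
rewrite exchange_big; apply: leq_sum => x _.
rewrite exchange_big; apply: leq_sum => y _.
rewrite exchange_big; apply: leq_sum => b _.
rewrite exchange_big; apply: leq_sum => b' _.
rewrite -big_distrl /= -[leqRHS]mul1n leq_mul2r; apply/orP; right.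
apply: sum_indicator_le1 => // l l' _ _ /and3P[xy /eqP e1 /eqP e2].
by move=> /and3P[_ /eqP e3 /eqP e4]; apply: affine_eq2 xy _ _; congruence.
Qed.

(* Szemeredi-Trotter for a cartesian product, in strong form: the cells have
   about [8|A|/k] times [8|B|/k] points, so that a [k]-rich line has at least
   [rich^2/k] pairs of points in a common cell. *)
Lemma rich_lines_bound (R : realFieldType) (A B : seq R) (L : seq (R * R))
    (k : nat) :
  uniq A -> uniq B -> uniq L -> 1 < k ->
  {in L, forall l, (l.1 != 0)%R /\ k <= rich A B l} ->
  k * \sum_(l <- L) rich A B l ^ 2 <= 81 * (size A * size B) ^ 2.
Proof.
move=> uA uB uL k1 Lk.
case: L uL Lk => [|l0 L'] uL Lk; first by rewrite big_nil muln0.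
set L := l0 :: L' in uL Lk *.
have [l00 kl0] : (l0.1 != 0)%R /\ k <= rich A B l0 by apply: Lk; apply: mem_head.
have kA : k <= size A by apply: leq_trans kl0 (rich_le_size1 _ _ _).
have kB : k <= size B by apply: leq_trans kl0 (rich_le_size2 l00 uA uB).
(* The least width with 8n < wk. As k <= n it satisfies kw <= 9n, and 81 is 9 squared. *)
pose w n := (8 * n %/ k).+1.
have wk n : 8 * n < w n * k by rewrite ltn_ceil // ltnW.
have kw n : k <= n -> k * w n <= 9 * n.
  by move=> kn; rewrite mulnS mulnC; have := leq_trunc_div (8 * n) k; lia.
have e1 : \sum_(l <- L) rich A B l ^ 2 <=
    k * \sum_(l <- L) close_pairs A B (w (size A)) (w (size B)) l.
  rewrite big_distrr big_seq [leqRHS]big_seq; apply: leq_sum => l /Lk[ln kl].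
  exact: rich_le_close_pairs.
have e2 : \sum_(l <- L) close_pairs A B (w (size A)) (w (size B)) l <=
    size A * w (size A) * (size B * w (size B)) by exact: sum_close_pairs_le.
have := kw _ kA; have := kw _ kB.
move: (w (size A)) (w (size B)) e1 e2 => wa wb e1 e2 hb ha.
apply: leq_trans (_ : k * (k * (size A * wa * (size B * wb))) <= _).
  by rewrite leq_mul2l (leq_trans e1) ?orbT // leq_mul2l e2 orbT.
have -> : k * (k * (size A * wa * (size B * wb))) =
   (size A * size B) * ((k * wa) * (k * wb)) by ring.
have -> : 81 * (size A * size B) ^ 2 =
   (size A * size B) * ((9 * size A) * (9 * size B)) by ring.
by rewrite leq_mul2l leq_mul ?orbT.
Qed.

(** Layer cake: r^2 is at most the sum of 2k over k <= r, so the fourth moment is bounded by second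
    moments over [k]-rich lines with weights 2k. Each of the |A| levels costs at most 162|A|^4. *)
Lemma rich_fourth_moment (R : realFieldType) (A : seq R) (L : seq (R * R)) :
  uniq A -> uniq L ->
  {in L, forall l, (l.1 != 0)%R /\ 1 < rich A A l} ->
  \sum_(l <- L) rich A A l ^ 4 <= 162 * size A ^ 5.
Proof.
move=> uA uL Lk; set n := size A.
have pw r : r <= n -> r ^ 2 <= \sum_(1 <= k < n.+1) (k <= r) * (2 * k).
  move=> rn; rewrite (big_cat_nat (n := r.+1)) //=.
  apply: leq_trans (leq_addr _ _).
  elim: r {rn} => [|r IH]; first by rewrite big_geq.
  rewrite big_nat_recr //= leqnn mul1n.
  apply: (@leq_trans (r ^ 2 + 2 * r.+1)); first lia.
  rewrite leq_add2r; apply: (leq_trans IH).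
  rewrite !big_nat; apply: leq_sum => k /andP[_ kr].
  rewrite leq_mul2r; apply/orP; right.
  by case: (leqP k r) => // kr'; rewrite (leq_trans kr').
apply: (@leq_trans (\sum_(l <- L) \sum_(1 <= k < n.+1)
    ((k <= rich A A l) * (2 * k)) * rich A A l ^ 2)).
  apply: leq_sum => l _; rewrite -big_distrl /= -[4]/(2 + 2) expnD.
  by rewrite leq_mul2r pw ?orbT // rich_le_size1.
rewrite exchange_big /=.
apply: (@leq_trans (\sum_(1 <= k < n.+1) 162 * n ^ 4)); last first.
  by rewrite sum_nat_const_nat subSS subn0 (expnS n 4); lia.
rewrite !big_nat; apply: leq_sum => k /andP[k0 _].
have -> : \sum_(l <- L) (k <= rich A A l) * (2 * k) * rich A A l ^ 2 =
   2 * (k * \sum_(l <- [seq l <- L | k <= rich A A l]) rich A A l ^ 2).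
  rewrite big_filter [in RHS]big_mkcond !big_distrr; apply: eq_bigr => l _ /=.
  by case: ifP; lia.
have -> : 162 * n ^ 4 = 2 * (81 * (n * n) ^ 2) by ring.
rewrite leq_mul2l /=.
have [k1|k1] := ltnP 1 k.
  apply: rich_lines_bound; rewrite ?filter_uniq // => l.
  by rewrite mem_filter => /andP[kl /Lk[]].
(* At level k = 1 the bound for 2-rich lines applies, as every line of [L] is 2-rich. *)
apply: leq_trans (_ : 2 * \sum_(l <- L) rich A A l ^ 2 <= _).
  apply: leq_mul; first exact: leqW.
  rewrite big_filter [leqLHS]big_mkcond; apply: leq_sum => l _.
  by case: ifP.
exact: rich_lines_bound.
Qed.

(** * Energy of a family of affine maps *)

(** Group by the value of [f]: the squared fibre sizes add up to the number of pairs with equal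
    values. *)
Lemma sum_comp_cauchy_schwarz (I K : eqType) (s : seq I) (f : I -> K)
    (g : K -> nat) :
  (\sum_(x <- s) g (f x)) ^ 2 <=
  (\sum_(x <- s) \sum_(y <- s) (f x == f y)) *
  \sum_(k <- undup (map f s)) g k ^ 2.
Proof.
set ks := undup _.
have uk : uniq ks by apply: undup_uniq.
have fk : {in s, forall x, f x \in ks}.
  by move=> x xs; rewrite mem_undup map_f.
have -> : \sum_(x <- s) \sum_(y <- s) (f x == f y) =
    \sum_(k <- ks) (\sum_(x <- s) (f x == k)) ^ 2.
  rewrite (sum_fibers _ uk fk); apply: eq_bigr => k _.
  rewrite -mulnn big_distrl /=; apply: eq_bigr => x _.
  case: eqP => [->|_]; rewrite ?mul0n // !mul1n.
  by apply: eq_bigr => y _; rewrite eq_sym.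
rewrite (sum_fibers _ uk fk).
under eq_bigr => k _.
  under eq_bigr => x _.
    rewrite (_ : _ * _ = (f x == k) * g k); last by case: eqP => // ->.
    over.
  rewrite -big_distrl /=.
  over.
exact: sum_cauchy_schwarz.
Qed.

(* [pencil_line (a, b)] is the line through [(0, a)] and [(1, b)]. *)
Definition pencil_line (R : realFieldType) (p : R * R) : R * R :=
  (p.2 - p.1, p.1)%R.

(* The affine map [pencil_line p]^-1 \o [pencil_line q]. *)
Definition transition (R : realFieldType) (p q : R * R) : R * R :=
  ((q.2 - q.1) / (p.2 - p.1), (q.1 - p.1) / (p.2 - p.1))%R.

(* The affine map sending [p.1] to [r.1] and [p.2] to [r.2], that is,
   [pencil_line r] \o [pencil_line p]^-1. *)
Definition transport (R : realFieldType) (p r : R * R) : R * R :=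
  ((r.2 - r.1) / (p.2 - p.1), r.1 - (r.2 - r.1) / (p.2 - p.1) * p.1)%R.

Lemma transitionP (R : realFieldType) (p q : R * R) (u v : R) :
  p.1 != p.2 -> affine (pencil_line p) u = affine (pencil_line q) v ->
  affine (transition p q) v = u.
Proof.
case: p q => [a b] [a' b'] /=; rewrite /affine /= eq_sym -subr_eq0 => p0 e.
by apply: (mulfI p0); rewrite -[RHS](addrK a) e; field.
Qed.

Lemma transport_fst (R : realFieldType) (p r : R * R) :
  affine (transport p r) p.1 = r.1.
Proof. by rewrite /affine /= addrC subrK. Qed.

Lemma transport_snd (R : realFieldType) (p r : R * R) :
  p.1 != p.2 -> affine (transport p r) p.2 = r.2.
Proof.
rewrite eq_sym -subr_eq0; case: p r => [a b] [a' b'] /= p0.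
by rewrite /affine /=; field.
Qed.

(** [transport p r] after the line of [q] is the line of [r] after the common transition, which is
    the line of [s]; compare values at 0 and 1. *)
Lemma transition_eq (R : realFieldType) (p q r s : R * R) :
  p.1 != p.2 -> r.1 != r.2 -> transition p q = transition r s ->
  affine (transport p r) q.1 = s.1 /\ affine (transport p r) q.2 = s.2.
Proof.
case: p q r s => [a b] [a' b'] [c d] [c' d'] /=.
rewrite eq_sym -subr_eq0 [c == _]eq_sym -(subr_eq0 d) => p0 r0 [e1 e2].
rewrite /affine /=.
have h1 : ((d - c) / (b - a) * a' + (c - (d - c) / (b - a) * a) =
           (a' - a) / (b - a) * (d - c) + c)%R by field.
have h2 : ((d - c) / (b - a) * b' + (c - (d - c) / (b - a) * a) =
           ((b' - a') / (b - a) + (a' - a) / (b - a)) * (d - c) + c)%R by field.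
by rewrite h1 h2 e1 e2; split; field.
Qed.

Definition grid (T : Type) (A B : seq T) : seq (T * T) :=
  [seq (a, b) | a <- A, b <- B].

(** Grid points whose pencil line is not constant, hence invertible as an affine map. *)
Definition off_diag (T : eqType) (A B : seq T) : seq (T * T) :=
  [seq p <- grid A B | p.1 != p.2].

Lemma sum_grid (T : Type) (A B : seq T) (F : T * T -> nat) :
  \sum_(p <- grid A B) F p = \sum_(a <- A) \sum_(b <- B) F (a, b).
Proof. exact: big_allpairs. Qed.

Lemma sum_off_diag_le (T : eqType) (A B : seq T) (F : T * T -> nat) :
  \sum_(p <- off_diag A B) F p <= \sum_(p <- grid A B) F p.
Proof.
by rewrite big_filter big_mkcond; apply: leq_sum => p _; case: ifP.
Qed.

Lemma size_off_diag (T : eqType) (A B : seq T) :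
  size (off_diag A B) <= size A * size B.
Proof. by rewrite size_filter (leq_trans (count_size _ _)) // size_allpairs. Qed.

Definition energy (R : realFieldType) (D : seq (R * R)) : nat :=
  \sum_(p <- D) \sum_(q <- D) \sum_(r <- D) \sum_(s <- D)
    (transition p q == transition r s).

Definition transports (R : realFieldType) (D : seq (R * R)) : seq (R * R) :=
  undup [seq transport p r | p <- D, r <- D].

(* [l1^-1 l2 = l3^-1 l4] if and only if [l3 l1^-1 = l4 l2^-1]. *)
Lemma energy_le_rich (R : realFieldType) (A B : seq R) :
  uniq A -> uniq B ->
  energy (off_diag A B) <=
  \sum_(f <- transports (off_diag A B)) (rich A A f * rich B B f) ^ 2.
Proof.
move=> uA uB; set D := off_diag A B; set Phi := transports D.
pose c f (p r : R * R) : nat := (affine f p.1 == r.1) && (affine f p.2 == r.2).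
have Dd p : p \in D -> p.1 != p.2 by rewrite mem_filter => /andP[].
apply: (@leq_trans (\sum_(p <- D) \sum_(q <- D) \sum_(r <- D) \sum_(s <- D)
    \sum_(f <- Phi) c f p r * c f q s)).
  rewrite /energy big_seq [leqRHS]big_seq; apply: leq_sum => p pD.
  apply: leq_sum => q _.
  rewrite big_seq [leqRHS]big_seq; apply: leq_sum => r rD.
  apply: leq_sum => s _; case: eqP => // /(transition_eq (Dd _ pD) (Dd _ rD)).
  move=> [e1 e2].
  have fP : transport p r \in Phi by rewrite mem_undup; apply: allpairs_f.
  rewrite (bigD1_seq _ fP) ?undup_uniq //= /c e1 e2 transport_fst.
  by rewrite transport_snd ?Dd // !eqxx leq_addr.
(* For fixed [f], the first coordinates of [p] and [r] are counted by [rich A A f] and,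
   independently, the second ones by [rich B B f]. *)
have cr f : \sum_(p <- D) \sum_(r <- D) c f p r <= rich A A f * rich B B f.
  apply: leq_trans (sum_off_diag_le _ _ _) _.
  apply: leq_trans (leq_sum _ (fun p _ => sum_off_diag_le _ _ _)) _.
  rewrite sum_grid !richE // big_distrl; apply: leq_sum => a _ /=.
  rewrite big_distrr; apply: leq_sum => b _ /=.
  rewrite sum_grid big_distrl; apply: leq_sum => a' _ /=.
  rewrite big_distrr; apply: leq_sum => b' _ /=.
  by rewrite /c /=; case: eqP; case: eqP.
apply: (@leq_trans (\sum_(f <- Phi) (\sum_(p <- D) \sum_(r <- D) c f p r) ^ 2));
  last by apply: leq_sum => f _; rewrite leq_sqr.
apply: eq_leq.
transitivity (\sum_(p <- D) \sum_(q <- D) \sum_(f <- Phi)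
   (\sum_(r <- D) c f p r) * (\sum_(s <- D) c f q s)).
  apply: eq_bigr => p _; apply: eq_bigr => q _.
  rewrite exchange_big /=.
  under eq_bigr => s _ do rewrite exchange_big /=.
  rewrite exchange_big /=; apply: eq_bigr => f _.
  rewrite exchange_big big_distrl /=; apply: eq_bigr => r _.
  by rewrite big_distrr.
under eq_bigr => p _ do rewrite exchange_big /=.
rewrite exchange_big /=; apply: eq_bigr => f _.
rewrite -mulnn big_distrl /=; apply: eq_bigr => p _.
by rewrite big_distrr.
Qed.

(** Sorts maps by which of the two richnesses exceeds 1, since the incidence bound starts at 2-rich
    lines. *)
Lemma sqr_split (a b : nat) :
  (a * b) ^ 2 <= (if (1 < a) && (1 < b) then a ^ 2 * b ^ 2 else 0) +
    (if 1 < a then a ^ 2 else 0) + (if 1 < b then b ^ 2 else 0) + 1.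
Proof.
case: (ltnP 1 a) => ha; case: (ltnP 1 b) => hb /=.
- by rewrite expnMn -!addnA leq_addr.
- rewrite add0n -addnA; apply: leq_trans (leq_addr _ _).
  by rewrite leq_sqr -[leqRHS]muln1 leq_mul2l hb orbT.
- rewrite !add0n; apply: leq_trans (leq_addr _ _).
  by rewrite leq_sqr -[leqRHS]mul1n leq_mul2r ha orbT.
- rewrite !add0n -[leqRHS](exp1n 2) leq_sqr -[leqRHS]mul1n.
  exact: leq_mul.
Qed.

(** Bounding cross terms by 2ab <= a^2 + b^2 gives the factor 4(162^2 + 81^2 + 81^2 + 1) = 157468 <=
    400^2. *)
Lemma sqr_sum4_bound (E e x y z Z : nat) :
  E <= e + 81 * x + 81 * y + z -> e ^ 2 <= 162 ^ 2 * Z ->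
  x ^ 2 <= Z -> y ^ 2 <= Z -> z ^ 2 <= Z -> E ^ 2 <= 400 ^ 2 * Z.
Proof.
move=> hE; rewrite -!mulnn => he hx hy hz.
have c a b : 2 * (a * b) <= a * a + b * b.
  by have := (nat_Cauchy a b).1; rewrite -!mulnn.
apply: leq_trans (leq_mul hE hE) _.
have := c e (81 * x); have := c e (81 * y); have := c e z.
have := c (81 * x) (81 * y); have := c (81 * x) z; have := c (81 * y) z.
nia.
Qed.

(** Maps rich for both sets are handled by Cauchy-Schwarz and the two fourth moments; those rich for
    one set contribute O(n^4) or O(m^4), the rest at most (nm)^2. The size hypotheses are what puts
    n^4 and m^4 below (nm)^(5/2). *)
Lemma energy_bound (R : realFieldType) (A B : seq R) :
  uniq A -> uniq B ->
  size B ^ 3 <= size A ^ 5 -> size A ^ 3 <= size B ^ 5 ->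
  energy (off_diag A B) ^ 2 <= 400 ^ 2 * (size A * size B) ^ 5.
Proof.
move=> uA uB hBA hAB; set Phi := transports (off_diag A B).
have uP : uniq Phi by apply: undup_uniq.
have PhiP f : f \in Phi -> (f.1 != 0)%R.
  rewrite mem_undup => /allpairsP[[p r] [/= pD rD ->]] /=.
  move: pD rD; rewrite !mem_filter => /andP[p0 _] /andP[r0 _].
  by rewrite mulf_neq0 ?invr_eq0 // subr_eq0 eq_sym.
pose al f := rich A A f; pose be f := rich B B f.
pose PhA := [seq f <- Phi | 1 < al f]; pose PhB := [seq f <- Phi | 1 < be f].
pose PhAB := [seq f <- Phi | (1 < al f) && (1 < be f)].
set n := size A in hBA hAB *; set m := size B in hBA hAB *.
have sA : 2 * \sum_(f <- PhA) al f ^ 2 <= 81 * (n * n) ^ 2.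
  apply: rich_lines_bound; rewrite ?filter_uniq // => f.
  by rewrite mem_filter => /andP[? /PhiP].
have sB : 2 * \sum_(f <- PhB) be f ^ 2 <= 81 * (m * m) ^ 2.
  apply: rich_lines_bound; rewrite ?filter_uniq // => f.
  by rewrite mem_filter => /andP[? /PhiP].
have sA4 : \sum_(f <- PhAB) (al f ^ 2) ^ 2 <= 162 * n ^ 5.
  under eq_bigr => f _ do rewrite -expnM.
  apply: rich_fourth_moment; rewrite ?filter_uniq // => f.
  by rewrite mem_filter => /andP[/andP[? ?] /PhiP].
have sB4 : \sum_(f <- PhAB) (be f ^ 2) ^ 2 <= 162 * m ^ 5.
  under eq_bigr => f _ do rewrite -expnM.
  apply: rich_fourth_moment; rewrite ?filter_uniq // => f.
  by rewrite mem_filter => /andP[/andP[? ?] /PhiP].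
have sP : size Phi <= (n * m) ^ 2.
  rewrite (leq_trans (size_undup _)) // size_allpairs -mulnn.
  by rewrite leq_mul // size_off_diag.
have := sum_cauchy_schwarz PhAB (fun f => al f ^ 2) (fun f => be f ^ 2).
set E22 := \sum_(f <- PhAB) _ => h22.
have hE : energy (off_diag A B) <=
    E22 + \sum_(f <- PhA) al f ^ 2 + \sum_(f <- PhB) be f ^ 2 + size Phi.
  apply: leq_trans (energy_le_rich uA uB) _.
  rewrite /E22 /PhA /PhB /PhAB !big_filter -sum1_size.
  rewrite [X in _ <= X + _ + _ + _]big_mkcond.
  rewrite [X in _ <= _ + X + _ + _]big_mkcond.
  rewrite [X in _ <= _ + X + _]big_mkcond -!big_split /=.
  apply: leq_sum => f _; rewrite -/(al f) -/(be f).
  exact: sqr_split.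
have h22' : E22 ^ 2 <= 162 ^ 2 * (n * m) ^ 5.
  apply: leq_trans h22 _; apply: leq_trans (leq_mul sA4 sB4) _.
  by rewrite mulnACA mulnn expnMn.
have n8 : (n ^ 4) ^ 2 <= (n * m) ^ 5.
  by rewrite -expnM -[4 * 2]/(5 + 3) expnD expnMn leq_mul2l hAB orbT.
have m8 : (m ^ 4) ^ 2 <= (n * m) ^ 5.
  by rewrite -expnM -[4 * 2]/(3 + 5) expnD expnMn leq_mul2r hBA orbT.
have nm : ((n * m) ^ 2) ^ 2 <= (n * m) ^ 5.
  rewrite -expnM; case: (posnP (n * m)) => [->//|h].
  by rewrite leq_pexp2l.
have half x y : 2 * x <= 81 * (y * y) ^ 2 -> x <= 81 * y ^ 4.
  by rewrite [y * y]mulnn -expnM; apply: leq_trans; apply: leq_pmull.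
apply: (sqr_sum4_bound _ h22' n8 m8 nm); apply: leq_trans hE _.
apply: leq_add sP; apply: leq_add (half _ _ sB).
by apply: leq_add (half _ _ sA).
Qed.

(** * Counting crossings *)

(* The abscissa at which [pencil_line p] and [pencil_line q] cross. *)
Definition crossing (R : realFieldType) (p q : R * R) : R :=
  ((q.1 - p.1) / ((q.1 - p.1) - (q.2 - p.2)))%R.

(** The join is neither vertical nor horizontal, and its slope is not 1, so the two pencil lines are
    not parallel. *)
Definition crossable (R : realFieldType) (p q : R * R) : bool :=
  [&& p.1 != q.1, p.2 != q.2 & (p.2 - p.1 != q.2 - q.1)%R].

Definition join_line (R : realFieldType) (p q : R * R) : R * R :=
  ((q.2 - p.2) / (q.1 - p.1), p.2 - (q.2 - p.2) / (q.1 - p.1) * p.1)%R.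

Lemma join_line_fst (R : realFieldType) (p q : R * R) :
  affine (join_line p q) p.1 = p.2.
Proof. by rewrite /affine /= addrC subrK. Qed.

Lemma join_line_snd (R : realFieldType) (p q : R * R) :
  p.1 != q.1 -> affine (join_line p q) q.1 = q.2.
Proof.
rewrite eq_sym -subr_eq0; case: p q => [a b] [a' b'] /= p0.
by rewrite /affine /=; field.
Qed.

(** The slope of the join is recovered from the crossing [u] as 1 - 1/u, and both joins pass through
    [p]. *)
Lemma crossing_inj (R : realFieldType) (p q r : R * R) :
  crossable p q -> crossable p r -> crossing p q = crossing p r ->
  join_line p q = join_line p r.
Proof.
case: p q r => [a b] [a1 b1] [a2 b2] /and3P[/= a10 _ d1] /and3P[/= a20 _ d2].
rewrite /crossing /join_line /= => e.
have h1 : (a1 - a != 0)%R by rewrite subr_eq0 eq_sym.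
have h2 : (a2 - a != 0)%R by rewrite subr_eq0 eq_sym.
have k1 : (a1 - a - (b1 - b) != 0)%R.
  apply: contra d1 => /eqP k; rewrite -subr_eq0 -[X in _ == X]k.
  by apply/eqP; ring.
have k2 : (a2 - a - (b2 - b) != 0)%R.
  apply: contra d2 => /eqP k; rewrite -subr_eq0 -[X in _ == X]k.
  by apply/eqP; ring.
suff -> : ((b1 - b) / (a1 - a) = (b2 - b) / (a2 - a))%R by [].
have f1 : ((b1 - b) / (a1 - a) = 1 - ((a1 - a) / (a1 - a - (b1 - b)))^-1)%R.
  by rewrite invf_div [X in (1 - X)%R]mulrBl divff // opprB [RHS]addrC subrK.
have f2 : ((b2 - b) / (a2 - a) = 1 - ((a2 - a) / (a2 - a - (b2 - b)))^-1)%R.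
  by rewrite invf_div [X in (1 - X)%R]mulrBl divff // opprB [RHS]addrC subrK.
by rewrite f1 f2 e.
Qed.

Lemma sum_grid_on_line (R : realFieldType) (A B : seq R) (l : R * R) :
  uniq B -> \sum_(p <- grid A B) (affine l p.1 == p.2) = rich A B l.
Proof. by move=> uB; rewrite sum_grid richE. Qed.

(** A line with r grid points carries at most r^2 ordered pairs, so [rich_lines_bound] applies to
    the joins. *)
Lemma pairs_on_rich_lines (R : realFieldType) (A B : seq R) (k : nat) :
  uniq A -> uniq B -> 1 < k ->
  k * \sum_(p <- grid A B) \sum_(q <- grid A B)
    [&& p.1 != q.1, p.2 != q.2 & k <= rich A B (join_line p q)] <=
  81 * (size A * size B) ^ 2.
Proof.
move=> uA uB k1; set G := grid A B.
pose P := fun x : (R * R) * (R * R) =>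
  [&& x.1.1 != x.2.1, x.1.2 != x.2.2 & k <= rich A B (join_line x.1 x.2)].
pose L := undup [seq join_line x.1 x.2 | x <- [seq x <- grid G G | P x]].
have uL : uniq L by apply: undup_uniq.
apply: (@leq_trans (k * \sum_(l <- L) rich A B l ^ 2)); last first.
  apply: rich_lines_bound => // l; rewrite mem_undup => /mapP[x].
  rewrite mem_filter => /andP[/and3P[x1 x2 x3] _] ->; split=> //=.
  by rewrite mulf_neq0 ?invr_eq0 // subr_eq0 eq_sym.
rewrite leq_mul2l; apply/orP; right.
apply: (@leq_trans (\sum_(p <- G) \sum_(q <- G) \sum_(l <- L)
    (affine l p.1 == p.2) * (affine l q.1 == q.2))).
  rewrite big_seq [leqRHS]big_seq; apply: leq_sum => p pG.
  rewrite big_seq [leqRHS]big_seq; apply: leq_sum => q qG.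
  case: and3P => // -[h1 h2 h3].
  have lL : join_line p q \in L.
    rewrite mem_undup; apply/mapP; exists (p, q) => //.
    by rewrite mem_filter /P /= h1 h2 h3; apply: allpairs_f.
  rewrite (bigD1_seq _ lL) //= join_line_fst join_line_snd // !eqxx.
  by rewrite leq_addr.
under eq_bigr => p _ do rewrite exchange_big /=.
rewrite exchange_big /=; apply: leq_sum => l _.
rewrite -(sum_grid_on_line _ _ uB) -/G -mulnn big_distrl; apply: leq_sum => p _.
by rewrite big_distrr.
Qed.

(* [324 = 4 * 81]: by [rich_lines_bound], at most a quarter of all pairs lie on
   [324]-rich lines. *)
Definition good_pair (R : realFieldType) (A B : seq R) (p q : R * R) : bool :=
  [&& p.1 != p.2, crossable p q & rich A B (join_line p q) < 324].

(** Each of the four degenerate families has at most N^2/32 pairs and the rich lines account for at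
    most N^2/4, so at most 3/8 of the pairs are lost. *)
Lemma many_good_pairs (R : realFieldType) (A B : seq R) :
  uniq A -> uniq B -> 32 <= size A -> 32 <= size B ->
  (size A * size B) ^ 2 <=
  2 * \sum_(p <- grid A B) \sum_(q <- grid A B) good_pair A B p q.
Proof.
move=> uA uB nA nB; set G := grid A B; set N := size A * size B.
have sG : size G = N by rewrite size_allpairs.
pose S (F : R * R -> R * R -> bool) := \sum_(p <- G) \sum_(q <- G) (F p q : nat).
have S1 : S (fun p q => p.1 == p.2) <= N * size A.
  rewrite /S exchange_big -sG; apply: sum_le_size => q _.
  rewrite sum_grid -[size A]muln1; apply: sum_le_size => a _.
  by rewrite sum_eq_indicator // leq_b1.
have S2 : S (fun p q => p.1 == q.1) <= N * size B.
  rewrite /S -sG; apply: sum_le_size => p _.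
  rewrite sum_grid exchange_big -[size B]muln1; apply: sum_le_size => b _ /=.
  by rewrite sum_eq_indicator // leq_b1.
have S3 : S (fun p q => p.2 == q.2) <= N * size A.
  rewrite /S -sG; apply: sum_le_size => p _.
  rewrite sum_grid -[size A]muln1; apply: sum_le_size => b _ /=.
  by rewrite sum_eq_indicator // leq_b1.
have S4 : S (fun p q => p.2 - p.1 == q.2 - q.1)%R <= N * size A.
  rewrite /S -sG; apply: sum_le_size => p _.
  rewrite sum_grid -[size A]muln1; apply: sum_le_size => b _ /=.
  by apply: sum_indicator_le1 => // x y _ _ /eqP -> /eqP /addIr.
have := pairs_on_rich_lines uA uB (isT : 1 < 324).
rewrite -/G -/(S (fun p q => _)) -/N => S5.
have : N ^ 2 <= S (good_pair A B) + S (fun p q => p.1 == p.2) +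
  S (fun p q => p.1 == q.1) + S (fun p q => p.2 == q.2) +
  S (fun p q => p.2 - p.1 == q.2 - q.1)%R +
  S (fun p q => [&& p.1 != q.1, p.2 != q.2 & 324 <= rich A B (join_line p q)]).
  rewrite -mulnn -sG -{1}sum1_size big_distrl /S -!big_split /=.
  apply: leq_sum => p _; rewrite mul1n -sum1_size -!big_split /=.
  apply: leq_sum => q _; rewrite /good_pair /crossable.
  rewrite (ltnNge (rich _ _ _)); move: (324 <= _) => c.
  case: (p.1 == p.2); case: (p.1 == q.1); case: (p.2 == q.2) => //.
  by case: (_ - _ == _)%R; case: c.
rewrite -/(S (good_pair A B)).
move: S1 S2 S3 S4 S5; rewrite -!mulnn.
move: (S _) (S _) (S _) (S _) (S _) (S _) => s1 s2 s3 s4 s5 s6.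
have : 32 * (N * size A) <= N * N 
  by rewrite mulnCA leq_mul2l /N [32 * _]mulnC leq_mul2l nB !orbT.
have : 32 * (N * size B) <= N * N 
  by rewrite mulnCA leq_mul2l /N leq_mul2r nA !orbT.
lia.
Qed.

Section Crossings.
Variables (R : realFieldType) (A B U T : seq R).
Hypotheses (uA : uniq A) (uB : uniq B) (uU : uniq U) (uT : uniq T).
Hypothesis crossUT : forall p q, p \in grid A B -> q \in grid A B ->
  crossable p q ->
  crossing p q \in U /\ affine (pencil_line p) (crossing p q) \in T.
Let D := off_diag A B.
Let N := size A * size B.
Let S := \sum_(p <- D) \sum_(u <- U) (affine (pencil_line p) u \in T).
(** Counts quadruples [(p, q, u, v)] for which the line of [p] at [u] and the line of [q] at [v]
    have the same height. *)
Let Q := \sum_(p <- D) \sum_(q <- D) rich U U (transition p q).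

(** A good pair [(p, q)] yields an incidence on the line of [p] at the crossing. All [q] yielding
    the same one lie on a single line through [p] with fewer than 324 grid points. *)
Lemma many_incidences : 32 <= size A -> 32 <= size B -> N ^ 2 <= 648 * S.
Proof.
move=> nA nB; apply: leq_trans (many_good_pairs uA uB nA nB) _.
rewrite -[648]/(2 * 324) -mulnA leq_mul2l /=.
set G := grid A B.
have fib p u : p \in G ->
    \sum_(q <- G) (good_pair A B p q && (crossing p q == u)) <= 324.
  move=> pG; have [/hasP[q0 q0G /andP[g0 /eqP c0]]|/hasPn no] :=
    boolP (has (fun q => good_pair A B p q && (crossing p q == u)) G); last first.
    by rewrite big_seq big1 // => q /no /negPf ->.
  move: (g0) => /and3P[_ cr0 r0]; apply: leq_trans (ltnW r0).
  rewrite -(sum_grid_on_line _ _ uB); apply: leq_sum => q _.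
  case: andP => // -[/and3P[_ cr _] /eqP cu].
  rewrite -(crossing_inj cr cr0) ?cu // join_line_snd ?eqxx //.
  by case/and3P: cr.
apply: (@leq_trans (\sum_(p <- D) \sum_(q <- G) good_pair A B p q)).
  rewrite big_filter [leqRHS]big_mkcond; apply: leq_sum => p _.
  by case: ifP => // pd; rewrite big1 // => q _; rewrite /good_pair pd.
rewrite /S big_distrr big_seq [leqRHS]big_seq; apply: leq_sum => p pD /=.
have pG : p \in G by move: pD; rewrite mem_filter => /andP[].
apply: (@leq_trans (\sum_(q <- G) \sum_(u <- U)
    (affine (pencil_line p) u \in T) *
    (good_pair A B p q && (crossing p q == u)))).
  rewrite big_seq [leqRHS]big_seq; apply: leq_sum => q qG.
  case gp: (good_pair A B p q) => //.
  have [cU cT] : crossing p q \in U /\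
      affine (pencil_line p) (crossing p q) \in T.
    by apply: crossUT => //; case/and3P: gp.
  by rewrite (bigD1_seq _ cU) //= cT eqxx leq_addr.
rewrite exchange_big big_distrr /=; apply: leq_sum => u _.
by rewrite -big_distrr /= mulnC leq_mul2r fib ?orbT.
Qed.

(** Cauchy-Schwarz over the heights in [T]: two incidences of equal height say that [transition p q]
    sends [v] to [u]. *)
Lemma incidences_cauchy_schwarz : S ^ 2 <= size T * Q.
Proof.
pose f (p : R * R) u := affine (pencil_line p) u.
have -> : S = \sum_(t <- T) \sum_(p <- D) \sum_(u <- U) (f p u == t).
  rewrite [RHS]exchange_big; apply: eq_bigr => p _.
  rewrite [RHS]exchange_big; apply: eq_bigr => u _.
  by rewrite sum_eq_indicator.
apply: leq_trans (sum_square_le _ _) _; rewrite leq_mul2l; apply/orP; right.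
under eq_bigr => t _ do rewrite -mulnn big_distrl /=.
rewrite exchange_big /Q big_seq [leqRHS]big_seq; apply: leq_sum => p pD /=.
have pd : p.1 != p.2 by move: pD; rewrite mem_filter => /andP[].
under eq_bigr => t _ do rewrite big_distrr /=.
rewrite exchange_big; apply: leq_sum => q _ /=.
under eq_bigr => t _ do rewrite mulnC big_distrl /=.
rewrite exchange_big; apply: leq_sum => v _ /=.
under eq_bigr => t _ do rewrite big_distrr /=.
rewrite exchange_big -(sum_eq_indicator _ uU) /=; apply: leq_sum => u _.
case: eqP => [_|ne].
  under eq_bigr => t _ do rewrite mulnb.
  by apply: sum_indicator_le1 => // x y _ _ /andP[/eqP <- _] /andP[/eqP <-].
rewrite big1 // => t _; case: eqP => // e1; case: eqP => // e2.
by case: ne; apply: transitionP => //; rewrite -/(f p u) e2.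
Qed.

(** [W] collects the pairs whose transition is [k]-rich on [U]. Grouping them by transition bounds
    W^2 by the energy times a sum of squared richnesses over distinct [k]-rich maps. *)
Lemma heavy_transitions (k : nat) : 1 < k ->
  exists W, Q <= k * N ^ 2 + W /\ k * W ^ 2 <= 81 * energy D * size U ^ 4.
Proof.
move=> k1; pose f (x : (R * R) * (R * R)) := transition x.1 x.2.
pose H := [seq x <- grid D D | k <= rich U U (f x)].
exists (\sum_(x <- H) rich U U (f x)); split.
  rewrite /Q -(sum_grid D D (fun x => rich U U (f x))).
  apply: (@leq_trans (\sum_(x <- grid D D)
    (k + if k <= rich U U (f x) then rich U U (f x) else 0))).
    apply: leq_sum => x _.
    have [_|/ltnW h] := leqP k (rich U U (f x)); first exact: leq_addl.
    by rewrite addn0.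
  rewrite big_split /=; apply: leq_add; last by rewrite big_filter -big_mkcond.
  apply: (@leq_trans (size (grid D D) * k)); first exact: sum_le_size.
  by rewrite mulnC leq_mul2l size_allpairs -mulnn leq_mul ?orbT ?size_off_diag.
have h := sum_comp_cauchy_schwarz H f (rich U U).
apply: leq_trans (leq_mul (leqnn k) h) _.
rewrite mulnCA [81 * _]mulnC -mulnA; apply: leq_mul.
  rewrite /H big_filter; under eq_bigr => x _ do rewrite big_filter.
  rewrite big_mkcond /energy sum_grid; apply: leq_sum => p _.
  apply: leq_sum => q _; case: ifP => // _.
  rewrite big_mkcond sum_grid; apply: leq_sum => r _; apply: leq_sum => s _.
  by case: ifP.
have -> : size U ^ 4 = (size U * size U) ^ 2 by rewrite mulnn -expnM.
apply: rich_lines_bound => //; first exact: undup_uniq.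
move=> l; rewrite mem_undup => /mapP[x]; rewrite mem_filter => /andP[kx].
move=> /allpairsP[[p q] [/= pD qD e]] ->; split=> //.
rewrite e /f /=; move: pD qD; rewrite !mem_filter => /andP[p0 _] /andP[q0 _].
by rewrite mulf_neq0 ?invr_eq0 // subr_eq0 eq_sym.
Qed.

End Crossings.

(** * Combining the estimates *)

(** With k about Q/(2N^2) the light part is at most Q/2, so Q <= 2W and Q^3 << N^2 E X^4. Inserting
    N^4 << XQ gives N^10 << E X^7, and E^2 << N^5 finishes. *)
Lemma combine_bounds (c d e N S Q E X : nat) :
  0 < N -> N ^ 2 <= c * S -> S ^ 2 <= X * Q ->
  (forall k, 1 < k ->
     exists W, Q <= k * N ^ 2 + W /\ k * W ^ 2 <= d * E * X ^ 4) ->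
  E ^ 2 <= e * N ^ 5 ->
  N ^ 15 <= ((4 * c ^ 2) ^ 14 + (16 * c ^ 6 * d) ^ 2 * e) * X ^ 14.
Proof.
move=> N0 hS hQ hW hE; rewrite mulnDl.
have N4 : N ^ 4 <= c ^ 2 * (X * Q).
  rewrite -[4]/(2 * 2) expnM (@leq_trans ((c * S) ^ 2)) ?leq_sqr //.
  by rewrite expnMn leq_mul2l hQ orbT.
have N20 : 0 < 2 * N ^ 2 by rewrite muln_gt0 expn_gt0 N0.
have [k1|k1] := ltnP 1 (Q %/ (2 * N ^ 2)); last first.
  (* For k <= 1 the trivial bound on [Q] already gives N^2 << X, and N^15 <= N^28. *)
  have hQ4 : Q <= 4 * N ^ 2.
    have := ltn_ceil Q N20; move: (_ %/ _) k1 => k; nia.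
  have N2 : N ^ 2 <= 4 * c ^ 2 * X.
    rewrite -(@leq_pmul2l (N ^ 2)) ?expn_gt0 ?N0 // -expnD.
    apply: leq_trans N4 _.
    apply: (@leq_trans (c ^ 2 * (X * (4 * N ^ 2)))).
      by rewrite !leq_mul2l hQ4 !orbT.
    by apply: eq_leq; ring.
  apply: leq_trans (leq_addr _ _); rewrite -expnMn.
  apply: (@leq_trans ((N ^ 2) ^ 14)); last by rewrite leq_exp2r.
  by rewrite -expnM leq_pexp2l.
have [W [QW kW]] := hW _ k1.
have kQ := leq_trunc_div Q (2 * N ^ 2); have := ltn_ceil Q N20.
move: (Q %/ _) k1 QW kW kQ => k k1 QW kW kQ Qk.
have Q2W : Q <= 2 * W by nia.
have Q4 : Q <= 4 * N ^ 2 * k by nia.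
have Q3 : Q ^ 3 <= 16 * d * N ^ 2 * E * X ^ 4.
  apply: (@leq_trans ((2 * W) ^ 2 * (4 * N ^ 2 * k))).
    by rewrite expnSr leq_mul // leq_sqr.
  apply: (@leq_trans (16 * N ^ 2 * (k * W ^ 2))); first by apply: eq_leq; ring.
  apply: (@leq_trans (16 * N ^ 2 * (d * E * X ^ 4))).
    by rewrite leq_mul2l kW orbT.
  by apply: eq_leq; ring.
have N10 : N ^ 10 <= 16 * c ^ 6 * d * E * X ^ 7.
  rewrite -(@leq_pmul2l (N ^ 2)) ?expn_gt0 ?N0 // -expnD.
  apply: (@leq_trans ((c ^ 2 * (X * Q)) ^ 3)).
    by rewrite -[2 + 10]/(4 * 3) expnM leq_exp2r.
  apply: (@leq_trans (c ^ 6 * X ^ 3 * Q ^ 3)); first by apply: eq_leq; ring.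
  apply: (@leq_trans (c ^ 6 * X ^ 3 * (16 * d * N ^ 2 * E * X ^ 4))).
    by rewrite leq_mul2l Q3 orbT.
  by apply: eq_leq; ring.
apply: leq_trans (leq_addl _ _).
rewrite -(@leq_pmul2l (N ^ 5)) ?expn_gt0 ?N0 // -expnD.
apply: (@leq_trans ((16 * c ^ 6 * d * E * X ^ 7) ^ 2)).
  by rewrite -[5 + 15]/(10 * 2) expnM leq_sqr.
apply: (@leq_trans ((16 * c ^ 6 * d) ^ 2 * X ^ 14 * E ^ 2)).
  by apply: eq_leq; ring.
apply: (@leq_trans ((16 * c ^ 6 * d) ^ 2 * X ^ 14 * (e * N ^ 5))).
  by rewrite leq_mul2l hE orbT.
by apply: eq_leq; ring.
Qed.

Lemma crossings_bound : exists C, forall (R : realFieldType)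
    (A B U T : seq R) (X : nat),
  uniq A -> uniq B -> uniq U -> uniq T -> 32 <= size A -> 32 <= size B ->
  size B ^ 3 <= size A ^ 5 -> size A ^ 3 <= size B ^ 5 ->
  (forall p q, p \in grid A B -> q \in grid A B -> crossable p q ->
   crossing p q \in U /\ affine (pencil_line p) (crossing p q) \in T) ->
  size U <= X -> size T <= X -> (size A * size B) ^ 15 <= C * X ^ 14.
Proof.
eexists => R A B U T X uA uB uU uT nA nB hBA hAB crossUT UX TX.
have N0 : 0 < size A * size B by rewrite muln_gt0 !(leq_trans _ nA, leq_trans _ nB).
apply: (combine_bounds (d := 81) N0 (many_incidences uA uB uU crossUT nA nB) _ _
   (energy_bound uA uB hBA hAB)).
  apply: leq_trans (incidences_cauchy_schwarz A B uU uT) _.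
  exact: leq_mul TX (leqnn _).
move=> k k1; have [W [h1 h2]] := heavy_transitions A B uU k1.
exists W; split; first exact: h1.
by apply: leq_trans h2 _; rewrite leq_mul2l leq_exp2r // UX orbT.
Qed.

Local Open Scope ring_scope.

(** * The projective plane *)

Lemma row3P (R : realType) (v w : 'rV[R]_3) :
  v 0 (inord 0) = w 0 (inord 0) -> v 0 (inord 1) = w 0 (inord 1) ->
  v 0 (inord 2) = w 0 (inord 2) -> v = w.
Proof.
move=> e0 e1 e2; apply/rowP => i; rewrite -[i]inord_val.
by case: i => [[|[|[|//]]] h].
Qed.

Lemma hvec0 (R : realType) (x y z : R) : hvec x y z 0 (inord 0) = x.
Proof. by rewrite mxE inordK. Qed.

Lemma hvec1 (R : realType) (x y z : R) : hvec x y z 0 (inord 1) = y.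
Proof. by rewrite mxE inordK. Qed.

Lemma hvec2 (R : realType) (x y z : R) : hvec x y z 0 (inord 2) = z.
Proof. by rewrite mxE inordK. Qed.

Definition hvecE := (hvec0, hvec1, hvec2).

Lemma mem_linfty (R : realType) (v : 'rV[R]_3) :
  (v \in linfty R) = (v 0 (inord 2) == 0).
Proof.
apply/idP/eqP => [/memv_addP[_ /vlineP[a ->] [_ /vlineP[b ->] ->]]|v0].
  by rewrite !mxE !inordK //= !mulr0 addr0.
apply/memv_addP; exists (v 0 (inord 0) *: hvec 1 0 0).
  by rewrite memvZ ?memv_line.
exists (v 0 (inord 1) *: hvec 0 1 0); first by rewrite memvZ ?memv_line.
by apply: row3P; rewrite !mxE !inordK //= ?mulr1 ?mulr0 ?addr0 ?add0r.
Qed.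

Lemma dim_linfty (R : realType) : is_pline (linfty R).
Proof.
rewrite /is_pline /linfty dimv_disjoint_sum ?dim_vline.
  have -> : hvec 1 0 0 != 0 :> 'rV[R]_3.
    by apply/eqP => /rowP/(_ (inord 0))/eqP; rewrite hvecE mxE oner_eq0.
  have -> // : hvec 0 1 0 != 0 :> 'rV[R]_3.
  by apply/eqP => /rowP/(_ (inord 1))/eqP; rewrite hvecE mxE oner_eq0.
apply/eqP; rewrite -subv0; apply/subvP => v /memv_capP[/vlineP[a ->]].
move=> /vlineP[b /rowP/(_ (inord 0))]; rewrite !mxE !inordK //=.
by rewrite mulr1 mulr0 => ->; rewrite scale0r mem0v.
Qed.

Lemma hpt_notin_linfty (R : realType) (p : R * R) : hpt p \notin linfty R.
Proof. by rewrite mem_linfty hvecE oner_eq0. Qed.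

Lemma mem_joinl (R : realType) (p q : R * R) :
  hpt p \in (<[hpt p]> + <[hpt q]>)%VS.
Proof. by rewrite (subvP (addvSl _ _)) ?memv_line. Qed.

Lemma mem_joinr (R : realType) (p q : R * R) :
  hpt q \in (<[hpt p]> + <[hpt q]>)%VS.
Proof. by rewrite addvC mem_joinl. Qed.

Lemma mem_join (R : realType) (p q r : R * R) : p <> q ->
  (hpt r \in (<[hpt p]> + <[hpt q]>)%VS) =
  ((r.1 - p.1) * (q.2 - p.2) == (r.2 - p.2) * (q.1 - p.1)).
Proof.
move=> pq; apply/idP/eqP => [/memv_addP[_ /vlineP[a ->] [_ /vlineP[b ->] e]]|e].
  have := congr1 (fun v : 'rV_3 => v 0 (inord 0)) e.
  have := congr1 (fun v : 'rV_3 => v 0 (inord 1)) e.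
  have := congr1 (fun v : 'rV_3 => v 0 (inord 2)) e.
  rewrite !mxE !inordK //= !mulr1 => e2 -> ->.
  have -> : a = 1 - b by rewrite e2 addrK.
  by ring.
suff [t e1 e2] : exists2 t, r.1 - p.1 = t * (q.1 - p.1) &
                            r.2 - p.2 = t * (q.2 - p.2).
  apply/memv_addP; exists ((1 - t) *: hpt p); first by rewrite memvZ ?memv_line.
  exists (t *: hpt q); first by rewrite memvZ ?memv_line.
  apply: row3P; rewrite !mxE !inordK //=.
  - by rewrite -[LHS](subrK p.1) e1; ring.
  - by rewrite -[LHS](subrK p.2) e2; ring.
  - by ring.
have [e1|n1] := eqVneq (q.1 - p.1) 0; last first.
  exists ((r.1 - p.1) / (q.1 - p.1)); first by rewrite divfK.
  by rewrite mulrAC e mulfK.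
have n2 : q.2 - p.2 != 0.
  apply/eqP => e2; apply: pq; move: e1 e2 => /subr0_eq e1 /subr0_eq e2.
  by rewrite [p]surjective_pairing [q]surjective_pairing e1 e2.
exists ((r.2 - p.2) / (q.2 - p.2)); last by rewrite divfK.
by rewrite mulrAC -e mulfK.
Qed.

Lemma affine_lineP (R : realType) (l : pspace R) : is_affine_line l ->
  exists p q, p <> q /\ l = (<[hpt p]> + <[hpt q]>)%VS.
Proof.
move=> [dl nl].
have [v vl v2] : exists2 v, v \in l & v 0 (inord 2) != 0.
  have [/subvP sub|/subvPn[v vl]] := boolP (l <= linfty R)%VS; last first.
    by rewrite mem_linfty; exists v.
  case: nl; apply/eqP; rewrite eqEdim dl dim_linfty leqnn andbT.
  exact/subvP.
pose p := (v 0 (inord 0) / v 0 (inord 2), v 0 (inord 1) / v 0 (inord 2)).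
have vp : hpt p = (v 0 (inord 2))^-1 *: v.
  by apply: row3P; rewrite !mxE !inordK //= ?mulVf // mulrC.
have pl : hpt p \in l by rewrite vp memvZ.
have [w wl wp] : exists2 w, w \in l & w \notin <[hpt p]>%VS.
  have [/dimvS|/subvPn[w wl wp]] := boolP (l <= <[hpt p]>)%VS; last by exists w.
  by rewrite dl dim_vline hpt_neq0.
(* Subtracting from [w] its multiple of [hpt p] with the same third coordinate leaves a direction;
   translating [p] along it gives a second affine point. *)
pose q := (p.1 + (w 0 (inord 0) - w 0 (inord 2) * p.1),
           p.2 + (w 0 (inord 1) - w 0 (inord 2) * p.2)).
have qE : hpt q = hpt p + (w - w 0 (inord 2) *: hpt p).
  by apply: row3P; rewrite !mxE !inordK //= mulr1 subrr addr0.
have pq : p <> q.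
  move=> pq; move: qE; rewrite -pq => /eqP.
  rewrite -{1}[hpt p]addr0 => /eqP/addrI/esym/subr0_eq wE.
  by move: wp; rewrite wE memvZ ?memv_line.
exists p, q; split=> //; apply/eqP; rewrite eq_sym eqEdim hpt_join_dim // dl.
rewrite leqnn andbT subv_add -!memvE pl qE.
by rewrite rpredD // rpredB // memvZ.
Qed.

Lemma slanted_lineP (R : realType) (l : pspace R) :
  is_affine_line l -> ~ vertical l -> ~ horizontal l ->
  exists m k, m != 0 /\ forall r, (hpt r \in l) = (r.2 == m * r.1 + k).
Proof.
move=> /affine_lineP[p [q [pq ->]]] nv nh.
have [e1|n1] := eqVneq (q.1 - p.1) 0.
  case: nv; exists p.1; apply/seteqP; split=> r; rewrite /affine_part /=.
    rewrite mem_join // e1 mulr0 mulf_eq0 => /orP[|/eqP e2].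
      by rewrite subr_eq0 => /eqP.
    case: pq; rewrite [p]surjective_pairing [q]surjective_pairing.
    by rewrite (subr0_eq e1) (subr0_eq e2).
  by move=> er; rewrite mem_join // e1 er subrr mul0r mulr0.
have [e2|n2] := eqVneq (q.2 - p.2) 0.
  case: nh; exists p.2; apply/seteqP; split=> r; rewrite /affine_part /=.
    rewrite mem_join // e2 mulr0 eq_sym mulf_eq0 (negPf n1) orbF subr_eq0.
    by move/eqP.
  by move=> er; rewrite mem_join // e2 er subrr mul0r mulr0.
exists ((q.2 - p.2) / (q.1 - p.1)), (p.2 - (q.2 - p.2) / (q.1 - p.1) * p.1).
split=> [|r]; first by rewrite mulf_neq0 ?invr_eq0.
rewrite mem_join //; apply/eqP/eqP => [e|->]; last by field.
have e' : r.2 - p.2 = (r.1 - p.1) * (q.2 - p.2) / (q.1 - p.1).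
  by rewrite e mulfK.
by rewrite -[LHS](subrK p.2) e'; ring.
Qed.

Lemma join_neq_linfty (R : realType) (p q : R * R) :
  (<[hpt p]> + <[hpt q]>)%VS <> linfty R.
Proof. by move=> e; have := hpt_notin_linfty p; rewrite -e mem_joinl. Qed.

Lemma LinesOnI (R : realType) (P : {fset R * R}) (l : pspace R)
    (p q : R * R) (v : 'rV[R]_3) :
  p \in P -> q \in P -> p <> q -> v != 0 ->
  (<[hpt p]> + <[hpt q]>)%VS <> l ->
  v \in (<[hpt p]> + <[hpt q]>)%VS -> v \in l -> LinesOn P l <[v]>%VS.
Proof.
move=> pP qP pq v0 nl vm vl; split; first by rewrite /is_ppoint dim_vline v0.
exists (<[hpt p]> + <[hpt q]>)%VS; split=> //.
split; last by exists p, q; split=> //; [exact: mem_joinl|exact: mem_joinr].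
split; [exact: hpt_join_dim|exact: join_neq_linfty].
Qed.

Lemma nmeet_ge (R : realType) (P : {fset R * R}) (l : pspace R)
    (s : seq (pspace R)) :
  is_pline l -> uniq s -> (forall x, x \in s -> LinesOn P l x) ->
  (size s <= nmeet P l)%N.
Proof.
move=> dl us sP; apply: uniq_leq_size => // x /sP xP.
by rewrite in_fset_set ?inE //; apply: LinesOn_finite.
Qed.

Lemma hpt_line_inj (R : realType) (p q : R * R) :
  <[hpt p]>%VS = <[hpt q]>%VS -> p = q.
Proof.
move=> e; apply/eqP/negP => /negP/eqP pq; have := hpt_join_dim pq.
by rewrite e addvv dim_vline hpt_neq0.
Qed.

Lemma nmeet_linfty_gt0 (R : realType) (P : {fset R * R}) :
  (1 < #|` P|)%N -> (0 < nmeet P (linfty R))%N.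
Proof.
case E: (P : seq _) (fset_uniq P) => [|p [|q s]] //.
rewrite /= => /andP[]; rewrite inE negb_or => /andP[/eqP pq _] _ _.
have pP : p \in P by rewrite -[_ \in _]/(p \in (P : seq _)) E mem_head.
have qP : q \in P by rewrite -[_ \in _]/(q \in (P : seq _)) E !inE eqxx orbT.
apply: (@nmeet_ge _ _ _ [:: <[hpt q - hpt p]>%VS]) => //.
  exact: dim_linfty.
move=> x; rewrite inE => /eqP ->; apply: (LinesOnI pP qP pq).
- rewrite subr_eq0; apply/eqP => e; apply: pq.
  by apply: hpt_line_inj; rewrite e.
- exact: join_neq_linfty.
- by rewrite rpredB ?mem_joinl ?mem_joinr.
- by rewrite mem_linfty !mxE !inordK //= subrr.
Qed.

(** * Crossings as projective points *)

Definition crossing_pairs (R : realFieldType) (A B : seq R) :=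
  [seq x <- grid (grid A B) (grid A B) | crossable x.1 x.2].

Definition crossing_xs (R : realFieldType) (A B : seq R) : seq R :=
  undup [seq crossing x.1 x.2 | x <- crossing_pairs A B].

Definition crossing_ys (R : realFieldType) (A B : seq R) : seq R :=
  undup [seq affine (pencil_line x.1) (crossing x.1 x.2)
        | x <- crossing_pairs A B].

Lemma mem_crossing_pairs (R : realFieldType) (A B : seq R)
    (x : (R * R) * (R * R)) :
  x \in crossing_pairs A B ->
  [/\ x.1 \in grid A B, x.2 \in grid A B & crossable x.1 x.2].
Proof.
by rewrite mem_filter => /andP[xc /allpairsP[[p q] [pG qG e]]]; rewrite e in xc *.
Qed.

Lemma mem_crossings (R : realFieldType) (A B : seq R) (p q : R * R) :
  p \in grid A B -> q \in grid A B -> crossable p q ->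
  crossing p q \in crossing_xs A B /\
  affine (pencil_line p) (crossing p q) \in crossing_ys A B.
Proof.
move=> pG qG pq; split; rewrite mem_undup; apply/mapP; exists (p, q) => //;
  by rewrite mem_filter pq; apply: allpairs_f.
Qed.

Section SlantedLine.
Variables (R : realType) (A B : {fset R}) (l : pspace R) (m k : R).
Hypotheses (dl : is_pline l) (m0 : m != 0).
Hypothesis lE : forall r, (hpt r \in l) = (r.2 == m * r.1 + k).
Let P := (A `*` B)%fset.
(** The change x -> mx + k of the first coordinate turns [l] into y = x; [g] undoes it. *)
Let A' := [seq m * a + k | a <- A].
Let g (p : R * R) : R * R := ((p.1 - k) / m, p.2).

Lemma mem_slanted_grid p : p \in grid A' B -> g p \in P.
Proof.
move=> /allpairsP[[a' b] [/mapP[a aA ->] bB ->]].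
by rewrite inE /g /= addrK mulrC mulKf // aA.
Qed.

(** A crossing [u] comes from a join of slope 1 - 1/u in the new coordinates, which is m(1 - 1/u) in
    the original ones; distinct [u] give distinct directions. *)
Lemma crossings_le_nmeet_linfty : (size (crossing_xs A' B) <= nmeet P (linfty R))%N.
Proof.
pose f u := <[hvec 1 (m * (1 - u^-1)) 0 : 'rV[R]_3]>%VS.
have fi : injective f.
  move=> u v; rewrite /f => e.
  have /vlineP[c /rowP h] : hvec 1 (m * (1 - u^-1)) 0 \in f v.
    by rewrite /f -e memv_line.
  have := h (inord 1); have := h (inord 0); rewrite !mxE !inordK //= mulr1.
  by move=> <-; rewrite mul1r => /(mulfI m0)/addrI/oppr_inj/invr_inj.
rewrite -(size_map f); apply: nmeet_ge; first exact: dim_linfty.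
  by rewrite map_inj_uniq // undup_uniq.
move=> _ /mapP[u + ->]; rewrite mem_undup => /mapP[[p q]] /mem_crossing_pairs /=.
move=> [/mem_slanted_grid pP /mem_slanted_grid qP /and3P[n1 n2 n3]] ->.
have pq : g p <> g q by case=> _ e2; move: n2; rewrite e2 eqxx.
apply: (LinesOnI pP qP pq).
- by apply/eqP => /rowP/(_ (inord 0))/eqP; rewrite hvecE mxE oner_eq0.
- exact: join_neq_linfty.
- have d0 : q.1 - p.1 != 0 by rewrite subr_eq0 eq_sym.
  have -> : hvec 1 (m * (1 - (crossing p q)^-1)) 0 =
      (m / (q.1 - p.1)) *: (hpt (g q) - hpt (g p)).
    apply: row3P; rewrite !mxE !inordK //= ?subrr ?mulr0 //.
      by field; rewrite m0 d0.
    by rewrite /crossing invf_div [X in 1 - X]mulrBl divff //; field.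
  by rewrite memvZ // rpredB ?mem_joinl ?mem_joinr.
- by rewrite mem_linfty hvecE.
Qed.

(** The join meets the diagonal at [(t, t)], with [t] the height of the crossing; [g] carries this
    point to [l]. *)
Lemma crossings_le_nmeet_slanted : (size (crossing_ys A' B) <= nmeet P l)%N.
Proof.
pose f t := <[hpt (g (t, t))]>%VS.
have fi : injective f by move=> u v /hpt_line_inj [_].
rewrite -(size_map f); apply: nmeet_ge => //.
  by rewrite map_inj_uniq // undup_uniq.
move=> _ /mapP[t + ->]; rewrite mem_undup => /mapP[[p q]] /mem_crossing_pairs /=.
move=> [/mem_slanted_grid pP /mem_slanted_grid qP /and3P[n1 n2 n3]] te.
have pq : g p <> g q by case=> _ e2; move: n2; rewrite e2 eqxx.
have gl r : (hpt (g r) \in l) = (r.2 == r.1).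
  by rewrite lE /g /= mulrC divfK // subrK.
apply: (LinesOnI pP qP pq).
- exact: hpt_neq0.
(* If the join were [l], both points would be on the diagonal and their pencil lines would both have
   slope 0. *)
- move=> e; move: n3.
  have : hpt (g p) \in l by rewrite -e mem_joinl.
  have : hpt (g q) \in l by rewrite -e mem_joinr.
  by rewrite !gl => /eqP -> /eqP ->; rewrite !subrr eqxx.
- have d0 : q.1 - p.1 - (q.2 - p.2) != 0.
    apply: contra n3 => /eqP e; rewrite -subr_eq0 -[X in _ == X]e.
    by apply/eqP; ring.
  rewrite mem_join //= te /affine /crossing /=; apply/eqP; field.
  by rewrite m0.
- by rewrite gl.
Qed.


End SlantedLine.

(** * From the counting bound to real exponents *)

Lemma card_fsetM (K K' : choiceType) (A : {fset K}) (B : {fset K'}) :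
  #|` (A `*` B)%fset| = (#|` A| * #|` B|)%N.
Proof.
rewrite -(size_allpairs pair (A : seq K) (B : seq K')); apply: perm_size.
apply: uniq_perm; first exact: fset_uniq.
  by apply: allpairs_uniq; rewrite ?fset_uniq // => -[? ?] [? ?].
move=> [a b]; rewrite in_fsetM /=.
apply/andP/allpairsP => [[aA bB]|[[a' b'] [aA bB [-> ->]]]] //.
by exists (a, b).
Qed.

Lemma nmeet_nat_bound : exists C, forall (R : realType) (A B : {fset R})
    (l : pspace R),
  (#|` B| ^ 3 <= #|` A| ^ 5)%N -> (#|` A| ^ 3 <= #|` B| ^ 5)%N ->
  #|` (A `*` B)%fset| <> 1%N ->
  is_affine_line l -> ~ vertical l -> ~ horizontal l ->
  ((#|` A| * #|` B|) ^ 15 <=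
    C * maxn (nmeet (A `*` B)%fset (linfty R)) (nmeet (A `*` B)%fset l) ^ 14)%N.
Proof.
have [C hC] := crossings_bound.
exists (C + (32 * 32 ^ 2) ^ 15)%N => R A B l hBA hAB P1 ll nv nh.
set X := maxn _ _.
have [N0|N0] := posnP (#|` A| * #|` B|)%N; first by rewrite N0.
(* A nonempty product other than a single point has two points, hence a direction. *)
have X0 : (0 < X)%N.
  rewrite leq_max nmeet_linfty_gt0 //.
  by move: P1 N0; rewrite card_fsetM; case: (_ * _)%N => [|[]].
have [/andP[nA nB]|small] := boolP ((32 <= #|` A|) && (32 <= #|` B|))%N.
  have [m [k [m0 lE]]] := slanted_lineP ll nv nh.
  have uA : uniq [seq m * a + k | a <- A].
    by rewrite map_inj_uniq ?fset_uniq // => x y /addIr /(mulfI m0).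
  apply: leq_trans (leq_mul (leq_addr _ C) (leqnn _)).
  have sA : size [seq m * a + k | a <- A] = #|` A| by rewrite size_map.
  rewrite -sA; move: nA hBA hAB; rewrite -sA => nA hBA hAB.
  apply: (hC _ _ _ _ _ _ uA (fset_uniq B) (undup_uniq _) (undup_uniq _)
    nA nB hBA hAB (@mem_crossings _ _ _)).
  - by rewrite leq_max crossings_le_nmeet_linfty.
  - by rewrite leq_max (crossings_le_nmeet_slanted A B (proj1 ll) m0 lE) orbT.
apply: (@leq_trans ((32 * 32 ^ 2) ^ 15 * X ^ 14)%N); last first.
  by rewrite leq_mul2r leq_addl orbT.
apply: (@leq_trans ((32 * 32 ^ 2) ^ 15)%N); last first.
  by rewrite leq_pmulr // expn_gt0 X0.
(* If one set has at most 32 elements, the other has at most 32^2 since 5/3 < 2; the constant then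
   suffices because X >= 1. *)
have sq x y : (x <= 32 -> y ^ 3 <= x ^ 5 -> y <= 32 ^ 2)%N.
  move=> x32 yx; rewrite -(@leq_exp2r _ _ 3) //; apply: leq_trans yx _.
  apply: (@leq_trans (32 ^ 5)%N); first by rewrite leq_exp2r.
  by rewrite -expnM leq_pexp2l.
rewrite leq_exp2r //.
move: small; rewrite negb_and -!ltnNge => /orP[] /ltnW h.
  by rewrite leq_mul // (sq _ _ h).
by rewrite mulnC leq_mul // (sq _ _ h).
Qed.

Lemma le_powR_natX (R : realType) (a b i j : nat) : (0 < j)%N ->
  (b%:R <= (a%:R : R) `^ (i%:R / j%:R)) = (b ^ j <= a ^ i)%N.
Proof.
move=> j0; rewrite -(@ler_pXn2r _ j) ?nnegrE ?powR_ge0 //.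
rewrite -[leRHS]powR_mulrn ?powR_ge0 // -powRrM divfK ?pnatr_eq0 -?lt0n //.
by rewrite powR_mulrn // -!natrX ler_nat.
Qed.

Lemma powR_natX_le (R : realType) (a b i j : nat) : (0 < j)%N ->
  ((a%:R : R) `^ (i%:R / j%:R) <= b%:R) = (a ^ i <= b ^ j)%N.
Proof.
move=> j0; rewrite -(@ler_pXn2r _ j) ?nnegrE ?powR_ge0 //.
rewrite -[leLHS]powR_mulrn ?powR_ge0 // -powRrM divfK ?pnatr_eq0 -?lt0n //.
by rewrite powR_mulrn // -!natrX ler_nat.
Qed.

Theorem theorem7 (R : realType) :
  exists2 c : R, 0 < c &
    forall (A B : {fset R}) (l1 : {vspace 'rV[R]_3}),
      (#|` B|%:R : R) <= #|` A|%:R `^ (5 / 3) ->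
      (#|` A|%:R : R) `^ (3 / 5) <= #|` B|%:R ->
      #|` (A `*` B)%fset| <> 1%N ->
      is_affine_line l1 -> ~ vertical l1 -> ~ horizontal l1 ->
      c * #|` A|%:R `^ (15 / 14) * #|` B|%:R `^ (15 / 14) <=
        (maxn (nmeet (A `*` B)%fset (linfty R)) (nmeet (A `*` B)%fset l1))%:R.
Proof.
have [C hC] := nmeet_nat_bound.
have r0 : 0 < (C.+1%:R : R) `^ 14^-1 by rewrite powR_gt0 // ltr0n.
(* The constant is (C + 1)^(-1/14), with the successor ensuring positivity. *)
exists ((C.+1%:R `^ 14^-1)^-1); first by rewrite invr_gt0.
move=> A B l hBA hAB P1 ll nv nh.
rewrite -mulrA ler_pdivrMl // -powRM //.
set X := maxn _ _.
rewrite -(@ler_pXn2r _ 14) ?nnegrE ?mulr_ge0 ?powR_ge0 //.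
rewrite exprMn -!powR_mulrn ?powR_ge0 // -!powRrM.
rewrite divfK ?pnatr_eq0 // mulVf ?pnatr_eq0 //.
rewrite powRr1 // !powR_mulrn ?mulr_ge0 // -natrM -!natrX -natrM ler_nat.
apply: leq_trans (hC R A B l _ _ P1 ll nv nh) _.
- by rewrite le_powR_natX in hBA.
- by rewrite powR_natX_le in hAB.
by rewrite leq_mul2r leqnSn orbT.
Qed.
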